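(* For any angle $\alpha\in(0,\pi/2)$ and any constant $q\in(0,1)$ there is a piecewise smooth planar curve such that its arc-length parameterization $g=g_{q,\alpha}:\mathbb{R}\to\mathbb{C}$ has the following properties: (a) $g([0,1])$ is a horizontal interval, and there exists $L_{q,\alpha}>0$ such that $g([1+L_{q,\alpha},+\infty))$ and $g((-\infty,-L_{q,\alpha}])$ are horizontal rays; (b) there exists $t_{q,\alpha}>1/2$ such that the arguments of $z_{+}=g(1/2+t_{q,\alpha})-g(1/2)$ and $z_{-}=g(1/2-t_{q,\alpha})-g(1/2)$ are equal to $-\alpha$ and $\pi+\alpha$ respectively; (c) $|g(t)-g(s)|/|t-s|>q$ for all $s\in[0,1]$ and all $t\in\mathbb{R}$ with $t\neq s$.
   Context: The plane is identified with $\mathbb{C}$ with the Euclidean norm $|\cdot|$; arc length is Euclidean arc length, and arguments of complex numbers are understood modulo $2\pi$. ''Horizontal'' means parallel to the real axis. *)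

(* Defs.v *)
From Stdlib Require Import Reals List.
From Coquelicot Require Import Coquelicot.
Open Scope R_scope.

Definition smooth (f : R -> C) : Prop :=
  forall (n : nat) (t : R),
    ex_derive_n (fun x => Re (f x)) n t /\ ex_derive_n (fun x => Im (f x)) n t.

(* Smoothness on a closed interval, i.e. up to the end points, is the existence
   of a smooth extension.  The interval [a, b] ranges over all compact intervals
   without breakpoint in their interior, so the pieces cut out by the finite
   list [l], including the two unbounded ones, are covered. *)
Definition piecewise_smooth (g : R -> C) : Prop :=
  (forall t : R, continuous g t) /\
  exists l : list R,
    forall a b : R, a < b -> (forall x : R, In x l -> ~ (a < x < b)) ->
      exists h : R -> C, smooth h /\ forall t : R, a <= t <= b -> g t = h t.

(* [len] is the length of a polygonal line with vertices on g, for a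
   subdivision of [a, b] into n + 1 intervals; [sum_f_R0 _ n] has n + 1 terms. *)
Definition inscribed_length (g : R -> C) (a b len : R) : Prop :=
  exists (n : nat) (sigma : nat -> R),
    sigma 0%nat = a /\ sigma (S n) = b /\
    (forall i : nat, (i <= n)%nat -> sigma i <= sigma (S i)) /\
    len = sum_f_R0 (fun i => Cmod (g (sigma (S i)) - g (sigma i))%C) n.

Definition is_arc_length (g : R -> C) (a b len : R) : Prop :=
  is_lub (inscribed_length g a b) len.

Definition arc_length_parametrized (g : R -> C) : Prop :=
  forall a b : R, a <= b -> is_arc_length g a b (b - a).

Definition image (g : R -> C) (I : R -> Prop) (z : C) : Prop :=
  exists t : R, I t /\ g t = z.

Definition horizontal_interval (A : C -> Prop) : Prop :=
  exists a b y : R, a < b /\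
    forall z : C, A z <-> (a <= Re z <= b /\ Im z = y).

Definition horizontal_ray (A : C -> Prop) : Prop :=
  exists (w : C) (e : R), (e = 1 \/ e = -1) /\
    forall z : C, A z <-> exists r : R, 0 <= r /\ z = (w + RtoC (e * r))%C.

(* theta is one of the arguments of z, which are determined modulo 2 PI. *)
Definition has_arg (z : C) (theta : R) : Prop :=
  z <> RtoC 0 /\ z = (Cmod z * cos theta, Cmod z * sin theta).

(* Main.v *)
Require Import Defs.
From Stdlib Require Import Reals Lra Lia List.
From Coquelicot Require Import Coquelicot.
Open Scope R_scope.

(** The curve is the primitive of [exp (i theta)] vanishing at 1/2, for an angle
    [theta] that is odd about 1/2, hence the curve is symmetric in a vertical axis.
    To the right, [theta] is 0 up to 1, slides down to some [- beta] with
    [alpha < beta < PI / 2], stays there until the argument of the curve has passed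
    [- alpha] (intermediate value theorem), and then slides back to 0.  The slides
    are proportional to [ln (1 + t^2)] with a small factor [eps]: on the scale of
    [t] the direction is nearly constant, and projecting a chord on its final
    direction shows that it has at least [1 - 2 eps] times the length of its arc. *)

(** * Comparison of derivatives *)

(** Mean value theorem for [g - f]. It stands in for integrating an inequality: the chord estimates
    below reduce to pointwise comparisons of derivatives. *)
Lemma derive_compare (f g f' g' : R -> R) (s t : R) :
  s <= t ->
  (forall u, s <= u <= t -> is_derive f u (f' u)) ->
  (forall u, s <= u <= t -> is_derive g u (g' u)) ->
  (forall u, s <= u <= t -> f' u <= g' u) ->
  f t - f s <= g t - g s.
Proof.
  intros Hst Hf Hg Hle.
  assert (Hd : forall u, s <= u <= t ->
            is_derive (fun v => g v - f v) u (g' u - f' u)).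
  { intros u Hu. apply (is_derive_minus g f u (g' u) (f' u)); auto. }
  destruct (MVT_gen (fun v => g v - f v) s t (fun u => g' u - f' u))
    as [c [Hc Heq]]; rewrite ?Rmin_left, ?Rmax_right in * by lra.
  - intros u Hu; apply Hd; lra.
  - intros u Hu. apply continuity_pt_filterlim.
    apply (ex_derive_continuous (fun v => g v - f v)).
    eexists; apply Hd; lra.
  - specialize (Hle c Hc). nra.
Qed.

Lemma derive_compare_eq (f g f' g' : R -> R) (s t : R) :
  s <= t ->
  (forall u, s <= u <= t -> is_derive f u (f' u)) ->
  (forall u, s <= u <= t -> is_derive g u (g' u)) ->
  (forall u, s <= u <= t -> f' u = g' u) ->
  f t - f s = g t - g s.
Proof.
  intros Hst Hf Hg Heq.
  apply Rle_antisym.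
  - apply (derive_compare f g f' g'); auto.
    intros u Hu; rewrite Heq; auto; lra.
  - apply (derive_compare g f g' f'); auto.
    intros u Hu; rewrite Heq; auto; lra.
Qed.

Lemma is_derive_lin_comb (f g : R -> R) (c d t l m : R) :
  is_derive f t l -> is_derive g t m ->
  is_derive (fun u => c * f u + d * g u) t (c * l + d * m).
Proof.
  intros Hf Hg.
  apply (is_derive_plus (fun u => c * f u) (fun u => d * g u) t (c * l) (d * m));
    now apply is_derive_scal.
Qed.

Lemma is_derive_linear (c t : R) : is_derive (fun u => c * u) t c.
Proof. auto_derive; auto; ring. Qed.

Lemma is_derive_reflect (f : R -> R) (c t l : R) :
  is_derive f (c - t) l -> is_derive (fun u => f (c - u)) t (- l).
Proof.
  intros Hf.
  replace (- l) with (-1 * l) by ring.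
  apply (is_derive_comp f (fun u => c - u)); auto.
  auto_derive; auto; ring.
Qed.

Lemma continuous_primitive (f : R -> R) (c : R) :
  (forall t, continuous f t) ->
  exists F : R -> R, F c = 0 /\ forall t, is_derive F t (f t).
Proof.
  intros Hf. exists (fun t => RInt f c t). split.
  - apply (RInt_point c f).
  - intros t. apply (is_derive_RInt f (fun t => RInt f c t) c t); auto.
    exists (mkposreal 1 Rlt_0_1). intros u _.
    apply (RInt_correct f c u), ex_RInt_continuous; auto.
Qed.

(** The derivative of [cos] is at least -1, and [cos] is even. *)
Lemma one_minus_abs_le_cos (d : R) : 1 - Rabs d <= cos d.
Proof.
  assert (Hpos : forall e, 0 <= e -> 1 - e <= cos e).
  { intros e He.
    assert (H := derive_compare (fun u => -1 * u) cos (fun _ => -1)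
                   (fun u => - sin u) 0 e He).
    rewrite cos_0 in H.
    enough (-1 * e - -1 * 0 <= cos e - 1) by lra.
    apply H.
    - intros u _; apply is_derive_linear.
    - intros u _; apply is_derive_cos.
    - intros u _. generalize (SIN_bound u); lra. }
  unfold Rabs; destruct (Rcase_abs d).
  - rewrite <- cos_neg. apply Hpos; lra.
  - apply Hpos; lra.
Qed.

(** * Functions with derivatives of all orders *)

(** Derivatives are given as functions on the whole line rather than through [Derive_n], so that
    closure properties follow by induction on [n]. *)
Fixpoint diff_n (n : nat) (f : R -> R) : Prop :=
  match n with
  | O => True
  | S m => exists f' : R -> R, (forall t, is_derive f t (f' t)) /\ diff_n m f'
  end.

Lemma diff_n_S (n : nat) (f : R -> R) : diff_n (S n) f -> diff_n n f.
Proof.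
  revert f; induction n as [|n IH]; intros f; [simpl; auto|].
  intros [f' [Hf Hf']]. exists f'; split; auto.
Qed.

Lemma diff_n_ex_derive_n (n : nat) (f : R -> R) (t : R) :
  diff_n n f -> ex_derive_n f n t.
Proof.
  revert f t; induction n as [|n IH]; intros f t; [simpl; auto|].
  intros [f' [Hf Hf']].
  destruct n as [|m].
  - exists (f' t); apply Hf.
  - assert (H := IH f' t Hf').
    change (ex_derive (Derive_n f' m) t) in H.
    change (ex_derive (Derive_n f (S m)) t).
    apply (ex_derive_ext (Derive_n f' m)); auto.
    intros u. rewrite <- (Nat.add_1_r m), <- Derive_n_comp.
    apply Derive_n_ext. intros v. symmetry. apply is_derive_unique, Hf.
Qed.

Lemma diff_n_const (n : nat) (c : R) : diff_n n (fun _ => c).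
Proof.
  revert c; induction n as [|n IH]; intros c; simpl; auto.
  exists (fun _ => 0); split; auto.
  intros t. apply (is_derive_const c t).
Qed.

Lemma diff_n_linear (n : nat) (c : R) : diff_n n (fun t => c * t).
Proof.
  destruct n as [|n]; simpl; auto.
  exists (fun _ => c); split; [intros t; apply is_derive_linear|apply diff_n_const].
Qed.

Lemma diff_n_plus (n : nat) (f g : R -> R) :
  diff_n n f -> diff_n n g -> diff_n n (fun t => f t + g t).
Proof.
  revert f g; induction n as [|n IH]; intros f g; simpl; auto.
  intros [f' [Hf Hf']] [g' [Hg Hg']].
  exists (fun t => f' t + g' t); split; auto.
  intros t; apply (is_derive_plus f g t (f' t) (g' t)); auto.
Qed.

Lemma diff_n_mult (n : nat) (f g : R -> R) :
  diff_n n f -> diff_n n g -> diff_n n (fun t => f t * g t).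
Proof.
  revert f g; induction n as [|n IH]; intros f g; [simpl; auto|].
  intros Hf0 Hg0.
  (* The product rule brings back [f] and [g] themselves, now at order [n]. *)
  assert (Hfn := diff_n_S n f Hf0). assert (Hgn := diff_n_S n g Hg0).
  destruct Hf0 as [f' [Hf Hf']], Hg0 as [g' [Hg Hg']].
  exists (fun t => f' t * g t + f t * g' t); split.
  - intros t. apply (is_derive_mult f g t (f' t) (g' t)); auto.
    intros a b; apply Rmult_comm.
  - apply diff_n_plus; auto.
Qed.

Lemma diff_n_reflect (n : nat) (f : R -> R) (c : R) :
  diff_n n f -> diff_n n (fun t => f (c - t)).
Proof.
  revert f; induction n as [|n IH]; intros f; simpl; auto.
  intros [f' [Hf Hf']].
  exists (fun t => -1 * f' (c - t)); split.
  - intros t. replace (-1 * f' (c - t)) with (- f' (c - t)) by ring.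
    apply is_derive_reflect, Hf.
  - apply diff_n_mult; [apply diff_n_const|auto].
Qed.

(** Each of [cos] and [sin] appears in the derivative of the other, so one induction treats both. *)
Lemma diff_n_cos_sin (n : nat) (f : R -> R) :
  diff_n n f -> diff_n n (fun t => cos (f t)) /\ diff_n n (fun t => sin (f t)).
Proof.
  revert f; induction n as [|n IH]; intros f; [simpl; auto|].
  intros Hf0. destruct (IH f (diff_n_S n f Hf0)) as [Hc Hs].
  destruct Hf0 as [f' [Hf Hf']]. split.
  - exists (fun t => f' t * (-1 * sin (f t))); split.
    + intros t. replace (-1 * sin (f t)) with (- sin (f t)) by ring.
      apply (is_derive_comp cos f); [apply is_derive_cos|apply Hf].
    + repeat apply diff_n_mult; auto using diff_n_const.
  - exists (fun t => f' t * cos (f t)); split.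
    + intros t. apply (is_derive_comp sin f); [apply is_derive_sin|apply Hf].
    + apply diff_n_mult; auto.
Qed.

(** The derivative is [-2 t] times the square of the same function, so the induction closes. *)
Lemma diff_n_inv_1p_sqr (n : nat) : diff_n n (fun t => / (1 + t * t)).
Proof.
  induction n as [|n IH]; [simpl; auto|].
  exists (fun t => (-2 * t) * (/ (1 + t * t) * / (1 + t * t))); split.
  - intros t. auto_derive; [nra|]. field; nra.
  - apply diff_n_mult; [apply diff_n_linear|apply diff_n_mult; auto].
Qed.

(** * The logarithmic ramp *)

(** Smooth and unbounded, so that a small multiple still turns by any angle; yet [u psi'(u) <= 2],
    so it varies little on the scale of [u]. *)
Definition psi (u : R) : R := ln (1 + u * u).

Lemma is_derive_psi (u : R) : is_derive psi u ((2 * u) * / (1 + u * u)).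
Proof. unfold psi. auto_derive; [nra|]. field; nra. Qed.

Lemma diff_n_psi (n : nat) : diff_n n psi.
Proof.
  destruct n as [|n]; simpl; auto.
  exists (fun u => (2 * u) * / (1 + u * u)); split; [apply is_derive_psi|].
  apply diff_n_mult; [apply diff_n_linear|apply diff_n_inv_1p_sqr].
Qed.

Lemma psi_increasing (u v : R) : 0 <= u <= v -> psi u <= psi v.
Proof. intros H. apply ln_le; nra. Qed.

(** The squares of [w - 1] and [w + 1] give [|2 w| <= 1 + w^2], so the derivative is at most 1 in
    absolute value. *)
Lemma psi_lipschitz (u v : R) : u <= v -> Rabs (psi v - psi u) <= v - u.
Proof.
  intros Huv.
  assert (Hb : forall w, -1 <= (2 * w) * / (1 + w * w) <= 1).
  { intros w. assert (0 < 1 + w * w) by nra.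
    assert (0 <= (w - 1) * (w - 1)) by apply Rle_0_sqr.
    assert (0 <= (w + 1) * (w + 1)) by apply Rle_0_sqr.
    assert ((2 * w) * / (1 + w * w) * (1 + w * w) = 2 * w) by (field; lra).
    split; apply (Rmult_le_reg_r (1 + w * w)); auto; lra. }
  assert (H1 := derive_compare psi (fun w => 1 * w) _ (fun _ => 1) u v Huv
                  (fun w _ => is_derive_psi w) (fun w _ => is_derive_linear 1 w)
                  (fun w _ => proj2 (Hb w))).
  assert (H2 := derive_compare (fun w => -1 * w) psi (fun _ => -1) _ u v Huv
                  (fun w _ => is_derive_linear (-1) w) (fun w _ => is_derive_psi w)
                  (fun w _ => proj1 (Hb w))).
  apply Rabs_le; lra.
Qed.

(** Solve [1 + q^2 = (1 + p^2) exp c] for [q]. *)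
Lemma psi_reach (p c : R) : 0 < p -> 0 < c -> exists q, p < q /\ psi q = psi p + c.
Proof.
  intros Hp Hc.
  set (E := (1 + p * p) * exp c).
  assert (HE : 1 + p * p < E).
  { unfold E. assert (1 < exp c) by (generalize (exp_ineq1 c); lra). nra. }
  exists (sqrt (E - 1)).
  assert (Hsq : sqrt (E - 1) * sqrt (E - 1) = E - 1) by (apply sqrt_sqrt; nra).
  assert (0 <= sqrt (E - 1)) by apply sqrt_pos.
  split; [nra|].
  unfold psi. rewrite Hsq.
  replace (1 + (E - 1)) with ((1 + p * p) * exp c) by (unfold E; ring).
  rewrite ln_mult, ln_exp; auto using exp_pos; nra.
Qed.

Definition clip (p q u : R) : R := Rmax p (Rmin u q).

Definition ramp (p q u : R) : R := psi (clip p q u) - psi p.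

Lemma ramp_below (p q u : R) : p <= q -> u <= p -> ramp p q u = 0.
Proof.
  intros. unfold ramp, clip.
  rewrite Rmin_left, Rmax_left by lra. ring.
Qed.

Lemma ramp_above (p q u : R) : p <= q -> q <= u -> ramp p q u = psi q - psi p.
Proof.
  intros. unfold ramp, clip.
  rewrite Rmin_right, Rmax_right by lra. ring.
Qed.

Lemma ramp_between (p q u : R) : p <= u <= q -> ramp p q u = psi u - psi p.
Proof.
  intros. unfold ramp, clip.
  rewrite Rmin_left, Rmax_right by lra. ring.
Qed.

Lemma ramp_cases (p q u : R) : p <= q ->
  (u <= p /\ ramp p q u = 0) \/ (p <= u <= q /\ ramp p q u = psi u - psi p) \/
  (q <= u /\ ramp p q u = psi q - psi p).
Proof.
  intros Hpq.
  destruct (Rle_dec u p); [left; auto using ramp_below|].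
  destruct (Rle_dec u q).
  - right; left. rewrite ramp_between by lra. lra.
  - right; right. rewrite ramp_above by lra. lra.
Qed.

Lemma ramp_bounds (p q u : R) : 0 <= p <= q -> 0 <= ramp p q u <= psi q - psi p.
Proof.
  intros Hpq. assert (H := psi_increasing p q Hpq).
  destruct (ramp_cases p q u (proj2 Hpq)) as [[? ->]|[[? ->]|[? ->]]]; try lra.
  assert (psi p <= psi u) by (apply psi_increasing; lra).
  assert (psi u <= psi q) by (apply psi_increasing; lra). lra.
Qed.

(** Inside [[p, q]] the ramp moves exactly as [psi]; outside it rests while [psi] keeps
    increasing. *)
Lemma ramp_increment (p q u t : R) : 0 <= p <= q -> 0 <= u <= t ->
  0 <= ramp p q t - ramp p q u <= psi t - psi u.
Proof.
  intros Hpq Hut.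
  assert (Hm : forall v w, 0 <= v -> v <= w -> psi v <= psi w)
    by (intros; apply psi_increasing; lra).
  (* Nine positions of [u] and [t]; every instance of monotonicity is supplied with its premises,
     and [lra] selects those that apply. *)
  destruct (ramp_cases p q u (proj2 Hpq)) as [[? ->]|[[? ->]|[? ->]]];
  destruct (ramp_cases p q t (proj2 Hpq)) as [[? ->]|[[? ->]|[? ->]]];
  assert (H1 := Hm u t); assert (H2 := Hm u p); assert (H3 := Hm p u);
  assert (H4 := Hm q t); assert (H5 := Hm u q); assert (H6 := Hm q u);
  assert (H7 := Hm p t); assert (H8 := Hm t p); assert (H9 := Hm p q);
  assert (H10 := Hm t q); lra.
Qed.

Lemma ramp_lipschitz (p q u v : R) : u <= v -> p <= q ->
  Rabs (ramp p q v - ramp p q u) <= v - u.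
Proof.
  intros Huv Hpq.
  assert (Hc : clip p q u <= clip p q v <= clip p q u + (v - u)).
  { unfold clip, Rmax, Rmin; repeat destruct Rle_dec; lra. }
  unfold ramp.
  replace (psi (clip p q v) - psi p - (psi (clip p q u) - psi p))
    with (psi (clip p q v) - psi (clip p q u)) by ring.
  apply Rle_trans with (1 := psi_lipschitz _ _ (proj1 Hc)). lra.
Qed.

(** * Piecewise smooth real functions *)

(** The list is an argument because both coordinates of the curve must share their breakpoints. *)
Definition smooth_pieces (f : R -> R) (l : list R) : Prop :=
  forall a b : R, a < b -> (forall x : R, In x l -> ~ (a < x < b)) ->
    exists h : R -> R, (forall n, diff_n n h) /\ forall t, a <= t <= b -> f t = h t.

Lemma smooth_pieces_ramp (p q : R) : p <= q -> smooth_pieces (ramp p q) (p :: q :: nil).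
Proof.
  intros Hpq a b Hab Hl.
  assert (Hp := Hl p (or_introl eq_refl)).
  assert (Hq := Hl q (or_intror (or_introl eq_refl))).
  destruct (Rle_dec b p) as [Hb|Hb].
  { exists (fun _ => 0); split; [intros; apply diff_n_const|].
    intros; apply ramp_below; lra. }
  destruct (Rle_dec q a) as [Ha|Ha].
  { exists (fun _ => psi q - psi p); split; [intros; apply diff_n_const|].
    intros; apply ramp_above; lra. }
  exists (fun u => psi u + - psi p); split.
  - intros n; apply diff_n_plus; [apply diff_n_psi|apply diff_n_const].
  - intros t Ht; apply ramp_between; lra.
Qed.

Lemma smooth_pieces_lin_comb (c d : R) (f g : R -> R) (l m : list R) :
  smooth_pieces f l -> smooth_pieces g m ->
  smooth_pieces (fun t => c * f t + d * g t) (l ++ m).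
Proof.
  intros Hf Hg a b Hab Hl.
  destruct (Hf a b Hab) as [h [Hh Hfh]].
  { intros x Hx; apply Hl, in_or_app; auto. }
  destruct (Hg a b Hab) as [k [Hk Hgk]].
  { intros x Hx; apply Hl, in_or_app; auto. }
  exists (fun t => c * h t + d * k t); split.
  - intros n; apply diff_n_plus; apply diff_n_mult; auto using diff_n_const.
  - intros t Ht; rewrite Hfh, Hgk; auto.
Qed.

Lemma smooth_pieces_reflect (f : R -> R) (c : R) (l : list R) :
  smooth_pieces f l -> smooth_pieces (fun t => f (c - t)) (map (fun x => c - x) l).
Proof.
  intros Hf a b Hab Hl.
  destruct (Hf (c - b) (c - a)) as [h [Hh Hfh]]; [lra| |].
  { intros x Hx Hin. apply (Hl (c - x)); [|lra].
    apply (in_map (fun x => c - x)); auto. }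
  exists (fun t => h (c - t)); split.
  - intros n; apply diff_n_reflect; auto.
  - intros t Ht; apply Hfh; lra.
Qed.

(** On [[a, b]], [F] differs by a constant from a primitive of the smooth extension of [f], and that
    primitive is smooth on the whole line. *)
Lemma primitive_smooth_pieces (F f : R -> R) (l : list R) :
  (forall t, is_derive F t (f t)) -> smooth_pieces f l -> smooth_pieces F l.
Proof.
  intros HF Hf a b Hab Hl.
  destruct (Hf a b Hab Hl) as [h [Hh Hfh]].
  destruct (continuous_primitive h a) as [H [Ha HH]].
  { intros t. destruct (Hh 1%nat) as [h' [Hh' _]].
    apply (ex_derive_continuous h). eexists; apply Hh'. }
  exists (fun t => H t + F a); split.
  - intros n. apply diff_n_plus; [|apply diff_n_const].
    destruct n as [|n]; simpl; auto. exists h; auto.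
  - intros t Ht.
    assert (E := derive_compare_eq F H f h a t (proj1 Ht)).
    rewrite Ha in E.
    enough (F t - F a = H t - 0) by lra.
    apply E; auto. intros u Hu; apply Hfh; lra.
Qed.

Lemma smooth_pieces_cos_sin (f : R -> R) (l : list R) :
  smooth_pieces f l ->
  smooth_pieces (fun t => cos (f t)) l /\ smooth_pieces (fun t => sin (f t)) l.
Proof.
  intros Hf; split; intros a b Hab Hl; destruct (Hf a b Hab Hl) as [h [Hh Hfh]].
  - exists (fun t => cos (h t)); split.
    + intros n; apply diff_n_cos_sin; auto.
    + intros t Ht; rewrite Hfh; auto.
  - exists (fun t => sin (h t)); split.
    + intros n; apply diff_n_cos_sin; auto.
    + intros t Ht; rewrite Hfh; auto.
Qed.

(** * Curves with a prescribed tangent angle *)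

(** Cauchy-Schwarz, from Lagrange's identity: the squared modulus is the square of the dot product
    plus that of [c b - d a]. *)
Lemma Cmod_ge_dot (a b c d : R) : c * c + d * d = 1 -> c * a + d * b <= Cmod (a, b).
Proof.
  intros H. unfold Cmod; simpl.
  destruct (Rle_dec (c * a + d * b) 0).
  - apply Rle_trans with (1 := r), sqrt_pos.
  - rewrite <- (sqrt_Rsqr (c * a + d * b)) by lra.
    apply sqrt_le_1_alt. unfold Rsqr.
    assert (0 <= (c * b - d * a) * (c * b - d * a)) by apply Rle_0_sqr.
    replace (a * (a * 1) + b * (b * 1))
      with ((c * c + d * d) * (a * a + b * b)) by (rewrite H; ring).
    nra.
Qed.

(** Test the hypothesis on the direction of [(a, b)] itself. *)
Lemma Cmod_le_dot (a b m : R) : 0 <= m ->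
  (forall c d, c * c + d * d = 1 -> c * a + d * b <= m) -> Cmod (a, b) <= m.
Proof.
  intros Hm H.
  assert (Hr : Cmod (a, b) * Cmod (a, b) = a * a + b * b).
  { unfold Cmod; simpl. rewrite sqrt_sqrt by nra. ring. }
  destruct (Req_dec (Cmod (a, b)) 0) as [E|E]; [lra|].
  assert (0 <= Cmod (a, b)) by apply Cmod_ge_0.
  set (r := Cmod (a, b)) in *.
  replace r with (a / r * a + b / r * b).
  - apply H. transitivity ((a * a + b * b) / (r * r)); [field; auto|].
    rewrite Hr. field. rewrite <- Hr; nra.
  - transitivity ((a * a + b * b) / r); [field; auto|]. rewrite <- Hr. field; auto.
Qed.

(** The velocity is [exp (i theta)], written in coordinates to stay within real analysis. *)
Definition tangent_angle (x y theta : R -> R) : Prop :=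
  forall t, is_derive x t (cos (theta t)) /\ is_derive y t (sin (theta t)).

Lemma cos_sin_unit (a : R) : cos a * cos a + sin a * sin a = 1.
Proof. generalize (sin2_cos2 a); unfold Rsqr; lra. Qed.

(** The velocity has projection at most 1 on every unit direction [(c, d)]. *)
Lemma chord_le (x y theta : R -> R) (s t : R) :
  tangent_angle x y theta -> s <= t -> Cmod (x t - x s, y t - y s) <= t - s.
Proof.
  intros Hg Hst. apply Cmod_le_dot; [lra|]. intros c d Hcd.
  assert (H := derive_compare (fun u => c * x u + d * y u) (fun u => 1 * u)
    (fun u => c * cos (theta u) + d * sin (theta u)) (fun _ => 1) s t Hst).
  enough (c * x t + d * y t - (c * x s + d * y s) <= 1 * t - 1 * s) by lra.
  apply H.
  - intros u _; apply is_derive_lin_comb; apply Hg.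
  - intros u _; apply is_derive_linear.
  - intros u _. generalize (cos_sin_unit (theta u)).
    set (e := cos _); set (f := sin _). intros.
    assert (0 <= (c - e) * (c - e)) by apply Rle_0_sqr.
    assert (0 <= (d - f) * (d - f)) by apply Rle_0_sqr. nra.
Qed.

(* The chord is at least its projection on the final direction [theta t]. *)
Lemma chord_ge (x y theta P P' : R -> R) (s t : R) :
  tangent_angle x y theta -> s <= t ->
  (forall u, s <= u <= t -> is_derive P u (P' u)) ->
  (forall u, s <= u <= t -> P' u <= 1 - Rabs (theta u - theta t)) ->
  P t - P s <= Cmod (x t - x s, y t - y s).
Proof.
  intros Hg Hst HP Hle.
  set (c := cos (theta t)); set (d := sin (theta t)).
  apply Rle_trans with (c * (x t - x s) + d * (y t - y s)).
  - assert (H := derive_compare P (fun u => c * x u + d * y u)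
      P' (fun u => c * cos (theta u) + d * sin (theta u)) s t Hst HP).
    enough (P t - P s <= c * x t + d * y t - (c * x s + d * y s)) by lra.
    apply H.
    + intros u _; apply is_derive_lin_comb; apply Hg.
    + intros u Hu. apply Rle_trans with (1 := Hle u Hu).
      apply Rle_trans with (1 := one_minus_abs_le_cos _).
      rewrite cos_minus. unfold c, d; lra.
  - apply Cmod_ge_dot, cos_sin_unit.
Qed.

(** * Arc length from chord estimates, and continuity *)

Lemma telescope (sigma : nat -> R) (n : nat) :
  sum_f_R0 (fun i => sigma (S i) - sigma i) n = sigma (S n) - sigma 0%nat.
Proof. induction n as [|n IH]; simpl; [ring|]. rewrite IH; ring. Qed.

(** The upper bound telescopes over any subdivision. For the lower one, equal steps of length [h]
    give at least [(b - a) (1 - K h)], which tends to [b - a]. *)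
Lemma arc_length_parametrized_of_chords (g : R -> C) (K : R) :
  0 <= K ->
  (forall s t, s <= t -> Cmod (g t - g s)%C <= t - s) ->
  (forall s t, s <= t -> (t - s) * (1 - K * (t - s)) <= Cmod (g t - g s)%C) ->
  arc_length_parametrized g.
Proof.
  intros HK Hup Hlow a b Hab. split.
  - intros len [n [sigma [H0 [H1 [Hs ->]]]]].
    rewrite <- H0, <- H1, <- telescope.
    apply sum_Rle. intros i Hi. apply Hup, Hs, Hi.
  - intros M HM. apply Rnot_lt_le; intros Hlt.
    (* With [N = n + 1] steps, a bound [M] would force [N (b - a - M) <= K (b - a)^2]; this [n]
       violates it. *)
    destruct (INR_unbounded (K * (b - a) * (b - a) / (b - a - M))) as [n Hn].
    set (h := (b - a) / INR (S n)).
    assert (HSn : 0 < INR (S n)) by (apply lt_0_INR; lia).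
    assert (Hh : h * INR (S n) = b - a) by (unfold h; field; lra).
    assert (Hh0 : 0 <= h) by nra.
    assert (HMs : sum_f_R0 (fun i => Cmod (g (a + INR (S i) * h)%R
                                            - g (a + INR i * h)%R)%C) n <= M).
    { apply HM. exists n, (fun i => a + INR i * h). repeat split.
      - simpl; ring.
      - rewrite (Rmult_comm (INR (S n))), Hh. ring.
      - intros i _. rewrite S_INR. nra. }
    assert (Hsum : (h * (1 - K * h)) * INR (S n) <= M).
    { apply Rle_trans with (2 := HMs). rewrite <- sum_cte.
      apply sum_Rle. intros i _.
      assert (E : a + INR (S i) * h - (a + INR i * h) = h) by (rewrite S_INR; ring).
      assert (H := Hlow (a + INR i * h) (a + INR (S i) * h)).
      rewrite E in H. apply H. lra. }
    apply (Rmult_gt_compat_r (b - a - M)) in Hn; [|lra].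
    unfold Rdiv in Hn. rewrite Rmult_assoc, Rinv_l, Rmult_1_r in Hn by lra.
    assert (E : INR (S n) = INR n + 1) by apply S_INR.
    assert (0 <= INR n) by apply pos_INR.
    (* A second factor [N] makes [h] occur only through [h N = b - a]. *)
    assert (h * (1 - K * h) * INR (S n) * INR (S n) <= M * INR (S n)) by nra.
    assert (h * (1 - K * h) * INR (S n) * INR (S n)
            = (h * INR (S n)) * INR (S n) - K * (h * INR (S n)) * (h * INR (S n)))
      by ring.
    rewrite Hh in *. nra.
Qed.

Lemma continuous_lipschitz (f : R -> R) (K : R) : 0 < K ->
  (forall u v, u <= v -> Rabs (f v - f u) <= K * (v - u)) ->
  forall t, continuous f t.
Proof.
  intros HK Hf t. apply continuity_pt_filterlim. intros e He.
  exists (e / K); split; [apply Rdiv_lt_0_compat; lra|].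
  intros u [_ Hu]. simpl in *. unfold R_dist in *.
  apply (Rmult_lt_compat_l K) in Hu; auto.
  replace (K * (e / K)) with e in Hu by (field; lra).
  apply Rle_lt_trans with (2 := Hu).
  destruct (Rle_dec t u).
  - rewrite (Rabs_right (u - t)) by lra. apply Hf; auto.
  - rewrite Rabs_minus_sym, (Rabs_left (u - t)) by lra.
    replace (K * - (u - t)) with (K * (t - u)) by ring. apply Hf; lra.
Qed.

Lemma continuous_complex (x y : R -> R) (t : R) :
  continuous x t -> continuous y t -> continuous (fun u => (x u, y u) : C) t.
Proof.
  intros Hx Hy.
  apply (continuous_comp_2 x y (fun a b => (a, b) : C)); auto.
  apply (continuous_ext (fun z : C => z)); [intros [a b]; reflexivity|].
  apply continuous_id.
Qed.

(** * Symmetry, straight pieces and the logarithmic chord estimate *)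

(** For an odd angle, [x (1 - t)] and [- x t] have the same derivative, as do [y (1 - t)] and [y t],
    and they agree at 1/2. The case [t < 1/2] follows by exchanging [t] and [1 - t]. *)
Lemma tangent_angle_mirror (x y theta : R -> R) (t : R) :
  tangent_angle x y theta -> (forall u, theta (1 - u) = - theta u) ->
  x (1 / 2) = 0 -> x (1 - t) = - x t /\ y (1 - t) = y t.
Proof.
  intros Hg Hodd Hx0.
  assert (Hhalf : forall v, 1 / 2 <= v -> x (1 - v) = - x v /\ y (1 - v) = y v).
  { intros v Hv.
    assert (Ex := derive_compare_eq (fun u => x (1 - u)) (fun u => -1 * x u)
      (fun u => - cos (theta (1 - u))) (fun u => -1 * cos (theta u)) (1 / 2) v Hv).
    assert (Ey := derive_compare_eq (fun u => y (1 - u)) y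
      (fun u => - sin (theta (1 - u))) (fun u => sin (theta u)) (1 / 2) v Hv).
    cbv beta in Ex, Ey.
    replace (1 - 1 / 2) with (1 / 2) in Ex, Ey by field.
    rewrite Hx0 in Ex. split.
    - enough (x (1 - v) - 0 = -1 * x v - -1 * 0) by lra. apply Ex.
      + intros u _; apply is_derive_reflect, Hg.
      + intros u _; apply is_derive_scal, Hg.
      + intros u _. rewrite Hodd, cos_neg. ring.
    - enough (y (1 - v) - y (1 / 2) = y v - y (1 / 2)) by lra. apply Ey.
      + intros u _; apply is_derive_reflect, Hg.
      + intros u _; apply Hg.
      + intros u _. rewrite Hodd, sin_neg. ring. }
  destruct (Rle_dec (1 / 2) t) as [H|H]; auto.
  destruct (Hhalf (1 - t)) as [Ex Ey]; [lra|].
  replace (1 - (1 - t)) with t in Ex, Ey by ring. split; lra.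
Qed.

Lemma tangent_angle_zero (x y theta : R -> R) (s t : R) :
  tangent_angle x y theta -> s <= t -> (forall u, s <= u <= t -> theta u = 0) ->
  x t = x s + (t - s) /\ y t = y s.
Proof.
  intros Hg Hst H0. split.
  - enough (x t - x s = 1 * t - 1 * s) by lra.
    apply (derive_compare_eq x (fun u => 1 * u) (fun u => cos (theta u)) (fun _ => 1));
      auto using is_derive_linear.
    + intros u _; apply Hg.
    + intros u Hu; rewrite H0, cos_0; auto.
  - enough (y t - y s = 0 * t - 0 * s) by lra.
    apply (derive_compare_eq y (fun u => 0 * u) (fun u => sin (theta u)) (fun _ => 0));
      auto using is_derive_linear.
    + intros u _; apply Hg.
    + intros u Hu; rewrite H0, sin_0; auto.
Qed.

(* Integrating [psi t - psi u] over [s, t] by parts gives at most [2 (t - s)]: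
   this is where the slowness of the logarithm enters. *)
Lemma chord_ge_log (x y theta : R -> R) (eps s t : R) :
  tangent_angle x y theta -> 0 <= eps -> 0 <= s <= t ->
  (forall u, s <= u <= t -> Rabs (theta u - theta t) <= eps * (psi t - psi u)) ->
  (1 - 2 * eps) * (t - s) <= Cmod (x t - x s, y t - y s).
Proof.
  intros Hg He Hst Hth.
  (* Since [u psi'(u) <= 2], the function multiplied by [eps] has derivative at least
     [psi t - psi u]. The boundary term [eps (psi t - psi s) s] left in [P t - P s] is
     nonnegative. *)
  set (P := fun u => u - eps * ((psi t - psi u) * u + 2 * u)).
  set (P' := fun u => 1 - eps * ((psi t - psi u) - (2 * u) * / (1 + u * u) * u + 2)).
  apply Rle_trans with (P t - P s).
  - unfold P. assert (psi s <= psi t) by (apply psi_increasing; lra).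
    assert (0 <= eps * ((psi t - psi s) * s)) by (apply Rmult_le_pos; nra). nra.
  - apply (chord_ge x y theta P P'); auto; [lra| |].
    + intros u _. unfold P, P'.
      auto_derive; [eexists; apply is_derive_psi|].
      change (Derive (fun v => psi v) u) with (Derive psi u).
      rewrite (is_derive_unique _ _ _ (is_derive_psi u)). ring.
    + intros u Hu. unfold P'. specialize (Hth u Hu).
      assert (2 * u * / (1 + u * u) * u <= 2).
      { apply (Rmult_le_reg_r (1 + u * u)); [nra|].
        replace (2 * u * / (1 + u * u) * u * (1 + u * u)) with (2 * u * u)
          by (field; nra). nra. }
      nra.
Qed.

(** * An odd slowly varying angle *)

(** Rises over [[p0, p1]], rests, and descends over [[p2, p3]]; it returns to 0 when the two ramps
    have equal heights. *)
Definition bump (p0 p1 p2 p3 u : R) : R := ramp p0 p1 u - ramp p2 p3 u.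

(* Odd about 1/2, so that the curve is symmetric in a vertical axis. *)
Definition angle (eps p0 p1 p2 p3 t : R) : R :=
  eps * bump p0 p1 p2 p3 (1 - t) + - eps * bump p0 p1 p2 p3 t.

Lemma angle_odd (eps p0 p1 p2 p3 t : R) :
  angle eps p0 p1 p2 p3 (1 - t) = - angle eps p0 p1 p2 p3 t.
Proof. unfold angle. replace (1 - (1 - t)) with t by ring. ring. Qed.

(** For [t >= 0] the reflected bump is evaluated at [1 - t <= 1 <= p0], where it vanishes. *)
Lemma angle_right (eps p0 p1 p2 p3 t : R) :
  1 <= p0 <= p1 -> p1 <= p2 <= p3 -> 0 <= t ->
  angle eps p0 p1 p2 p3 t = - eps * bump p0 p1 p2 p3 t.
Proof.
  intros H1 H2 Ht. unfold angle, bump.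
  rewrite (ramp_below p0 p1 (1 - t)), (ramp_below p2 p3 (1 - t)) by lra. ring.
Qed.

Lemma angle_lipschitz (eps p0 p1 p2 p3 u v : R) :
  0 <= eps -> p0 <= p1 -> p2 <= p3 -> u <= v ->
  Rabs (angle eps p0 p1 p2 p3 v - angle eps p0 p1 p2 p3 u) <= 4 * eps * (v - u).
Proof.
  intros He H1 H2 Huv.
  assert (A := ramp_lipschitz p0 p1 u v Huv H1).
  assert (B := ramp_lipschitz p2 p3 u v Huv H2).
  assert (Huv' : 1 - v <= 1 - u) by lra.
  assert (A' := ramp_lipschitz p0 p1 _ _ Huv' H1).
  assert (B' := ramp_lipschitz p2 p3 _ _ Huv' H2).
  apply Rabs_le_between in A. apply Rabs_le_between in B.
  apply Rabs_le_between in A'. apply Rabs_le_between in B'.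
  unfold angle, bump. apply Rabs_le; split; nra.
Qed.

Lemma smooth_pieces_angle (eps p0 p1 p2 p3 : R) :
  p0 <= p1 -> p2 <= p3 -> exists l, smooth_pieces (angle eps p0 p1 p2 p3) l.
Proof.
  intros H1 H2.
  assert (Hb : smooth_pieces (bump p0 p1 p2 p3) (p0 :: p1 :: p2 :: p3 :: nil)).
  { intros a b Hab Hl.
    destruct (smooth_pieces_lin_comb 1 (-1) _ _ _ _
                (smooth_pieces_ramp p0 p1 H1) (smooth_pieces_ramp p2 p3 H2)
                a b Hab Hl) as [h [Hh Hbh]].
    exists h; split; auto.
    intros t Ht. rewrite <- Hbh by auto. unfold bump; ring. }
  eexists. apply smooth_pieces_lin_comb; [|exact Hb].
  apply (smooth_pieces_reflect _ 1), Hb.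
Qed.

(** The increments of both ramps lie between 0 and [psi t - psi u], hence so does the absolute value
    of their difference: no factor 2 is lost. *)
Lemma angle_variation (eps p0 p1 p2 p3 u t : R) :
  0 <= eps -> 1 <= p0 <= p1 -> p1 <= p2 <= p3 -> 0 <= u <= t ->
  Rabs (angle eps p0 p1 p2 p3 u - angle eps p0 p1 p2 p3 t) <= eps * (psi t - psi u).
Proof.
  intros He H1 H2 Hut.
  rewrite !angle_right by lra. unfold bump.
  assert (A := ramp_increment p0 p1 u t). assert (B := ramp_increment p2 p3 u t).
  assert (A' : 0 <= ramp p0 p1 t - ramp p0 p1 u <= psi t - psi u) by (apply A; lra).
  assert (B' : 0 <= ramp p2 p3 t - ramp p2 p3 u <= psi t - psi u) by (apply B; lra).
  apply Rabs_le; split; nra.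
Qed.

(** * From the angle to the properties of the curve *)

Lemma has_arg_polar (r theta : R) : 0 < r -> has_arg (r * cos theta, r * sin theta) theta.
Proof.
  intros Hr.
  assert (Hm : Cmod (r * cos theta, r * sin theta) = r).
  { unfold Cmod; simpl.
    replace (_ + _) with (r * r * (cos theta * cos theta + sin theta * sin theta))
      by ring.
    rewrite cos_sin_unit, Rmult_1_r. apply sqrt_square; lra. }
  split.
  - intros E. rewrite E, Cmod_0 in Hm. lra.
  - rewrite Hm; reflexivity.
Qed.

Lemma piecewise_smooth_of_angle (x y theta : R -> R) (l : list R) :
  tangent_angle x y theta -> smooth_pieces theta l ->
  piecewise_smooth (fun t => (x t, y t)).
Proof.
  intros Hg Hth. destruct (smooth_pieces_cos_sin theta l Hth) as [Hc Hs].
  split.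
  - intros t. apply continuous_complex.
    + apply (ex_derive_continuous x). exists (cos (theta t)); apply Hg.
    + apply (ex_derive_continuous y). exists (sin (theta t)); apply Hg.
  - exists l. intros a b Hab Hl.
    destruct (primitive_smooth_pieces x _ l (fun t => proj1 (Hg t)) Hc a b Hab Hl)
      as [h [Hh Hxh]].
    destruct (primitive_smooth_pieces y _ l (fun t => proj2 (Hg t)) Hs a b Hab Hl)
      as [k [Hk Hyk]].
    exists (fun t => (h t, k t)); split.
    + intros n t; split; apply diff_n_ex_derive_n; [apply Hh|apply Hk].
    + intros t Ht. rewrite Hxh, Hyk; auto.
Qed.

(** On [[s, t]] the angle deviates from [theta t] by at most [K (t - s)], so a linear [P] in
    [chord_ge] gives the required lower bound on chords. *)
Lemma arc_length_of_angle (x y theta : R -> R) (K : R) :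
  0 <= K -> tangent_angle x y theta ->
  (forall u v, u <= v -> Rabs (theta v - theta u) <= K * (v - u)) ->
  arc_length_parametrized (fun t => (x t, y t)).
Proof.
  intros HK Hg Hlip. apply (arc_length_parametrized_of_chords _ K); auto.
  - intros s t Hst. apply (chord_le x y theta s t Hg Hst).
  - intros s t Hst.
    replace ((t - s) * (1 - K * (t - s)))
      with ((1 - K * (t - s)) * t - (1 - K * (t - s)) * s) by ring.
    apply (chord_ge x y theta (fun u => (1 - K * (t - s)) * u)
             (fun _ => 1 - K * (t - s)) s t Hg Hst).
    + intros u _; apply is_derive_linear.
    + intros u Hu. rewrite Rabs_minus_sym.
      assert (H := Hlip u t (proj2 Hu)). nra.
Qed.

(** * Choice of the parameters and verification of the properties *)

Theorem lemma4p11 (alpha q : R) (halpha : 0 < alpha < PI / 2) (hq : 0 < q < 1) :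
  exists g : R -> C,
    piecewise_smooth g /\ arc_length_parametrized g /\
    (horizontal_interval (image g (fun t => 0 <= t <= 1)) /\
     exists L : R, 0 < L /\
       horizontal_ray (image g (fun t => 1 + L <= t)) /\
       horizontal_ray (image g (fun t => t <= - L))) /\
    (exists t : R, 1 / 2 < t /\
       has_arg (g (1 / 2 + t)%R - g (1 / 2)%R)%C (- alpha) /\
       has_arg (g (1 / 2 - t)%R - g (1 / 2)%R)%C (PI + alpha)) /\
    (forall s t : R, 0 <= s <= 1 -> t <> s ->
       q < Cmod (g t - g s)%C / Rabs (t - s)).
Proof.
  (* Then [1 - 2 eps = (1 + q) / 2 > q]. *)
  set (eps := (1 - q) / 4). assert (Heps : 0 < eps) by (unfold eps; lra).
  (* Above [alpha], so that the argument of the curve can pass [- alpha]; below [PI / 2], so that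
     [x] keeps increasing. *)
  set (beta := (alpha + PI / 2) / 2).
  assert (Hbeta : alpha < beta < PI / 2) by (unfold beta; lra).
  assert (Hc : 0 < beta / eps) by (apply Rdiv_lt_0_compat; lra).
  assert (Hec : eps * (beta / eps) = beta) by (field; lra).
  destruct (psi_reach 1 (beta / eps)) as [p1 [Hp1 Hpsi1]]; [lra|auto|].
  assert (Hsin : 0 < sin (beta - alpha)) by (apply sin_gt_0; lra).
  (* Long enough at angle [- beta] for the argument of the curve to pass [- alpha]. *)
  set (p2 := p1 + p1 / sin (beta - alpha)).
  assert (Hp2 : p1 < p2).
  { unfold p2. assert (0 < p1 / sin (beta - alpha)) by (apply Rdiv_lt_0_compat; lra).
    lra. }
  (* The same height as the first slide, so that the angle is 0 again from [p3] on. *)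
  destruct (psi_reach p2 (beta / eps)) as [p3 [Hp3 Hpsi3]]; [lra|auto|].
  set (theta := angle eps 1 p1 p2 p3).
  assert (Hodd : forall u, theta (1 - u) = - theta u) by (intros; apply angle_odd).
  assert (Hright : forall u, 0 <= u -> theta u = - eps * bump 1 p1 p2 p3 u)
    by (intros; apply angle_right; lra).
  assert (Hlip : forall u v, u <= v ->
            Rabs (theta v - theta u) <= 4 * eps * (v - u))
    by (intros; apply angle_lipschitz; lra).
  assert (Hcont : forall t, continuous theta t)
    by (apply (continuous_lipschitz theta (4 * eps)); auto; lra).
  (* Vanishing at 1/2 puts [g (1/2)] at the origin. *)
  destruct (continuous_primitive (fun t => cos (theta t)) (1 / 2)) as [x [Hx0 Hx]].
  { intros t. apply (continuous_comp theta cos); auto.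
    apply continuous_cos. }
  destruct (continuous_primitive (fun t => sin (theta t)) (1 / 2)) as [y [Hy0 Hy]].
  { intros t. apply (continuous_comp theta sin); auto.
    apply continuous_sin. }
  assert (Hg : tangent_angle x y theta) by (intros t; split; auto).
  assert (Hmirror : forall t, x (1 - t) = - x t /\ y (1 - t) = y t)
    by (intros t; apply (tangent_angle_mirror x y theta); auto).
  assert (Hth0 : forall u, 0 <= u <= 1 -> theta u = 0).
  { intros u Hu. rewrite Hright by lra. unfold bump.
    rewrite !ramp_below by lra. ring. }
  assert (Hmid : forall t, 0 <= t <= 1 -> x t = t - 1 / 2 /\ y t = 0).
  { assert (H : forall t, 1 / 2 <= t <= 1 -> x t = t - 1 / 2 /\ y t = 0).
    { intros t Ht. destruct (tangent_angle_zero x y theta (1 / 2) t Hg) as [Ex Ey];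
        [lra|intros; apply Hth0; lra|lra]. }
    intros t Ht. destruct (Rle_dec (1 / 2) t); [apply H; lra|].
    destruct (H (1 - t)) as [Ex Ey]; [lra|].
    destruct (Hmirror t); lra. }
  assert (Hray : forall t, p3 <= t -> x t = x p3 + (t - p3) /\ y t = y p3).
  { intros t Ht. apply (tangent_angle_zero x y theta); auto.
    intros u Hu. rewrite Hright by lra. unfold bump.
    rewrite !ramp_above by lra. rewrite Hpsi1, Hpsi3. ring. }
  exists (fun t => (x t, y t)). split; [|split; [|split; [split|split]]].
  - destruct (smooth_pieces_angle eps 1 p1 p2 p3) as [l Hl]; [lra|lra|].
    apply (piecewise_smooth_of_angle x y theta l); auto.
  - apply (arc_length_of_angle x y theta (4 * eps)); auto; lra.
  - exists (- (1 / 2)), (1 / 2), 0. split; [lra|]. intros [a b]; simpl. split.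
    + intros [t [Ht E]]. injection E as <- <-. destruct (Hmid t Ht); lra.
    + intros [Ha ->]. exists (a + 1 / 2). split; [lra|].
      destruct (Hmid (a + 1 / 2)) as [-> ->]; [lra|]. f_equal; ring.
  (* [1 + L = p3], and [- L = 1 - p3] is its mirror image. *)
  - exists (p3 - 1). split; [lra|]. split.
    + exists (x p3, y p3), 1. split; auto. intros z; split.
      * intros [t [Ht <-]]. exists (t - p3). split; [lra|].
        destruct (Hray t) as [-> ->]; [lra|].
        unfold Cplus, RtoC; simpl. f_equal; ring.
      * intros [r [Hr ->]]. exists (p3 + r). split; [lra|].
        destruct (Hray (p3 + r)) as [-> ->]; [lra|].
        unfold Cplus, RtoC; simpl. f_equal; ring.
    + exists (- x p3, y p3), (-1). split; auto. intros z; split.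
      * intros [t [Ht <-]]. exists (1 - t - p3). split; [lra|].
        destruct (Hray (1 - t)) as [Ex Ey]; [lra|].
        destruct (Hmirror t) as [Fx Fy].
        replace (x t) with (- (x p3 + (1 - t - p3))) by lra.
        replace (y t) with (y p3) by lra.
        unfold Cplus, RtoC; simpl. f_equal; ring.
      * intros [r [Hr ->]]. exists (1 - (p3 + r)). split; [lra|].
        destruct (Hmirror (p3 + r)) as [-> ->].
        destruct (Hray (p3 + r)) as [-> ->]; [lra|].
        unfold Cplus, RtoC; simpl. f_equal; ring.
  (* [F] is the imaginary part of [exp (i alpha) g]: it vanishes when [g] is on the line of
     direction [- alpha]. Its derivative is [sin (alpha + theta)]. *)
  - set (F := fun t => sin alpha * x t + cos alpha * y t).
    set (F' := fun t => sin alpha * cos (theta t) + cos alpha * sin (theta t)).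
    assert (HF : forall t, is_derive F t (F' t))
      by (intros t; apply is_derive_lin_comb; apply Hg).
    assert (Hsa : 0 < sin alpha) by (apply sin_gt_0; lra).
    assert (Hca : 0 < cos alpha) by (apply cos_gt_0; lra).
    assert (HF1 : 0 < F 1).
    { unfold F. destruct (Hmid 1) as [-> ->]; [lra|]. nra. }
    assert (HFp1 : F p1 <= p1 - 1 / 2).
    { enough (F p1 - F (1 / 2) <= 1 * p1 - 1 * (1 / 2)) as H.
      { unfold F at 2 in H. rewrite Hx0, Hy0 in H. lra. }
      apply (derive_compare F (fun u => 1 * u) F' (fun _ => 1)); [lra|auto| |].
      - intros; apply is_derive_linear.
      - intros u _. unfold F'. rewrite <- sin_plus. apply SIN_bound. }
    (* On [[p1, p2]] the slope of [F] is at most [- sin (beta - alpha)], so [F] loses at least [p1]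
       there, more than the bound [p1 - 1/2] on [F p1]. *)
    assert (HFp2 : F p2 < 0).
    { assert (H : F p2 - F p1 <= - sin (beta - alpha) * p2 - - sin (beta - alpha) * p1).
      { apply (derive_compare F (fun u => - sin (beta - alpha) * u) F'
                 (fun _ => - sin (beta - alpha))); [lra|auto| |].
        - intros; apply is_derive_linear.
        - intros u Hu. unfold F'. rewrite Hright by lra. unfold bump.
          rewrite (ramp_above 1 p1), (ramp_below p2 p3), Hpsi1 by lra.
          replace (- eps * (psi 1 + beta / eps - psi 1 - 0)) with (- beta) by lra.
          rewrite <- sin_plus, <- sin_neg. right; f_equal; ring. }
      replace (- sin (beta - alpha) * p2 - - sin (beta - alpha) * p1)
        with (- p1) in H by (unfold p2; field; lra).
      lra. }
    destruct (IVT_gen F 1 p2 0) as [T [HT HFT]].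
    { intros t. apply continuity_pt_filterlim, (ex_derive_continuous F).
      eexists; apply HF. }
    { rewrite Rmin_right, Rmax_left by lra. lra. }
    rewrite Rmin_left, Rmax_right in HT by lra.
    assert (HT1 : T <> 1) by (intros ->; lra).
    (* [F T = 0] leaves the arguments [- alpha] and [PI - alpha]; the sign of [x T] decides. Up to
       [p2] the angle stays in [[- beta, 0]], so [x] does not decrease from [x 1 = 1/2]. *)
    assert (HxT : 0 < x T).
    { assert (H : 0 * T - 0 * 1 <= x T - x 1).
      { apply (derive_compare (fun u => 0 * u) x (fun _ => 0) (fun u => cos (theta u)));
          [lra| |auto|].
        - intros; apply is_derive_linear.
        - intros u Hu. rewrite Hright by lra. unfold bump.
          rewrite (ramp_below p2 p3) by lra.
          assert (B : 0 <= ramp 1 p1 u <= psi p1 - psi 1) by (apply ramp_bounds; lra).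
          assert (eps * ramp 1 p1 u <= beta).
          { rewrite <- Hec. apply Rmult_le_compat_l; lra. }
          apply cos_ge_0; nra. }
      destruct (Hmid 1) as [E _]; lra. }
    set (r := x T / cos alpha).
    assert (Hr : 0 < r) by (apply Rdiv_lt_0_compat; lra).
    assert (Er : x T = r * cos alpha) by (unfold r; field; lra).
    assert (Ey : y T = - (r * sin alpha)).
    { apply (Rmult_eq_reg_l (cos alpha)); [|lra]. unfold F in HFT. nra. }
    exists (T - 1 / 2). split; [lra|].
    replace (1 / 2 + (T - 1 / 2)) with T by ring.
    replace (1 / 2 - (T - 1 / 2)) with (1 - T) by field.
    destruct (Hmirror T) as [-> ->]. rewrite Hx0, Hy0.
    split.
    + replace ((x T, y T) - (0, 0))%C with (r * cos (- alpha), r * sin (- alpha)).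
      { apply has_arg_polar; auto. }
      rewrite cos_neg, sin_neg, Er, Ey. unfold Cminus, Cplus, Copp; simpl.
      f_equal; ring.
    + replace (((- x T)%R, y T) - (0, 0))%C with (r * cos (PI + alpha), r * sin (PI + alpha)).
      { apply has_arg_polar; auto. }
      rewrite (Rplus_comm PI), neg_cos, neg_sin, Er, Ey.
      unfold Cminus, Cplus, Copp; simpl. f_equal; ring.
  - assert (Hfwd : forall s t, 0 <= s -> s < t ->
              q * (t - s) < Cmod (x t - x s, y t - y s)).
    { intros s t Hs Hst.
      apply Rlt_le_trans with ((1 - 2 * eps) * (t - s)).
      - apply Rmult_lt_compat_r; unfold eps; lra.
      - apply (chord_ge_log x y theta); auto; [lra|lra|].
        intros u Hu. apply angle_variation; lra. }
    intros s t Hs Hts.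
    assert (Habs : 0 < Rabs (t - s)) by (apply Rabs_pos_lt; lra).
    apply (Rmult_lt_reg_r (Rabs (t - s))); auto.
    unfold Rdiv; rewrite Rmult_assoc, Rinv_l, Rmult_1_r by lra.
    change ((x t, y t) - (x s, y s))%C with (x t - x s, y t - y s).
    destruct (Rle_dec s t).
    + rewrite Rabs_right by lra. apply Hfwd; lra.
    + rewrite Rabs_left by lra.
      (* A backward chord is the mirror image of the forward chord from [1 - s] to [1 - t], and
         [1 - s >= 0]. *)
      destruct (Hmirror t) as [Ex Ey], (Hmirror s) as [Fx Fy].
      assert (H := Hfwd (1 - s) (1 - t)).
      rewrite Ex, Ey, Fx, Fy in H.
      replace (Cmod (x t - x s, y t - y s))
        with (Cmod (- x t - - x s, y t - y s)).
      * replace (- (t - s)) with (1 - t - (1 - s)) by ring. apply H; lra.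
      * unfold Cmod; simpl. f_equal; ring.
Qed.
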